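(* Let $G$ be a weighted graph, let $x_1,x_2$ be distinct non-adjacent vertices of $G$, and let $c\neq 0$ be a real number. Then $$\det A(G) = \det A(G_{x_1+c\cdot x_2}).$$
   Context: A weighted graph $G$ is a triple $(V(G),E(G),w^G)$ where $(V(G),E(G))$ is a finite simple graph and $w^G$ is a real-valued symmetric weight function on all unordered pairs of distinct vertices such that $w^G(e)\neq 0$ if and only if $e\in E(G)$. By convention $w^G(aa)=0$ for every vertex $a$. The adjacency matrix $A(G)$ is indexed by $V(G)$, with $(a,b)$ entry $w^G(ab)$ for $a\ne b$ and $0$ on the diagonal. For distinct non-adjacent vertices $v,u$ of $G$ and a real number $c\neq 0$, the weighted graph $G_{v+c\cdot u}$ is defined by: $V(G_{v+c\cdot u})=V(G)$; for $b\neq v$, $w^{G_{v+c\cdot u}}(vb)=w^G(vb)+c\cdot w^G(bu)$; for distinct $a,b$ with $a\neq v\neq b$, $w^{G_{v+c\cdot u}}(ab)=w^G(ab)$; and $e\in E(G_{v+c\cdot u})$ if and only if $w^{G_{v+c\cdot u}}(e)\neq 0$. *)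

(* Defs.v *)
From HB Require Import structures.
From mathcomp Require Import all_boot all_order all_algebra.
From mathcomp Require Import reals.

Set Implicit Arguments.
Unset Strict Implicit.
Unset Printing Implicit Defensive.

Import GRing.Theory.
Local Open Scope ring_scope.

(* A weight on unordered pairs is encoded as a symmetric function of two
   arguments; [weight_diag] is the convention w(aa) = 0. *)
Record wgraph (R : realType) (V : finType) := WGraph {
  edge : rel V;
  weight : V -> V -> R;
  edge_sym : symmetric edge;
  edge_irr : irreflexive edge;
  weight_sym : forall a b, weight a b = weight b a;
  weight_diag : forall a, weight a a = 0;
  weight_edge : forall a b, a != b -> (weight a b != 0) = edge a b
}.

(* Rows and columns are indexed by V through its enumeration. *)
Definition adjmx (R : realType) (V : finType) (G : wgraph R V) : 'M[R]_#|V| :=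
  \matrix_(i, j) weight G (enum_val i) (enum_val j).

Section AddVertex.

Variables (R : realType) (V : finType) (G : wgraph R V) (v u : V) (c : R).

Definition add_weight (a b : V) : R :=
  if a == b then 0
  else if a == v then weight G v b + c * weight G b u
  else if b == v then weight G v a + c * weight G a u
  else weight G a b.

Definition add_edge : rel V := fun a b => add_weight a b != 0.

Lemma add_weight_diag a : add_weight a a = 0.
Proof. by rewrite /add_weight eqxx. Qed.

Lemma add_weight_sym a b : add_weight a b = add_weight b a.
Proof.
rewrite /add_weight eq_sym; case: (altP (b =P a)) => // neq_ba.
case: (eqVneq a v) => [av|_]; last by case: eqP => // _; rewrite weight_sym.
by case: (eqVneq b v) => // bv; rewrite av bv eqxx in neq_ba.
Qed.

Lemma add_edge_sym : symmetric add_edge.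
Proof. by move=> a b; rewrite /add_edge add_weight_sym. Qed.

Lemma add_edge_irr : irreflexive add_edge.
Proof. by move=> a; rewrite /add_edge add_weight_diag eqxx. Qed.

Lemma add_weight_edge a b : a != b -> (add_weight a b != 0) = add_edge a b.
Proof. by []. Qed.

(* The graph G_{v + c.u}.  The construction yields a weighted graph for all
   v, u and c, so no side conditions are needed here, although it is only
   intended for distinct non-adjacent v, u and nonzero c. *)
Definition add_vertex : wgraph R V :=
  WGraph add_edge_sym add_edge_irr add_weight_sym add_weight_diag
    add_weight_edge.

End AddVertex.

(* Main.v *)
(* Let P := 1 + c E_{x1 x2}.  As w(x1 x2) = 0 and w vanishes on the diagonal,
   the adjacency matrix of G_{x1 + c.x2} is P A(G) P^T, and det P = 1. *)
Require Import Defs.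
From HB Require Import structures.
From mathcomp Require Import all_boot all_order all_algebra.
From mathcomp Require Import reals.

Set Implicit Arguments.
Unset Strict Implicit.
Unset Printing Implicit Defensive.

Import GRing.Theory.
Local Open Scope ring_scope.

(** Passing to the new graph adds [c] times row [x2] to row [x1] and then does the same with columns
    ([adjmx_add_vertex]). Neither operation changes the determinant ([det_transvection]). The two
    operations overlap only at the diagonal entry of [x1], which stays 0 because [x1] and [x2] are
    non-adjacent. *)

Lemma det_transvection (R : comNzRingType) n (i j : 'I_n) (c : R) :
  i != j -> \det (1%:M + c *: delta_mx i j) = 1.
Proof.
move=> neq_ij.
(* [C] is the identity with row [i] replaced by row [j], hence singular. By linearity in row [i],
   the determinant sought is [\det 1 + c * \det C]. *)
pose C : 'M[R]_n := \matrix_(k, l) (if k == i then j == l else k == l)%:R.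
have C0 : \det C = 0.
  apply: (determinant_alternate neq_ij) => l.
  by rewrite !mxE eqxx (eq_sym j i) (negPf neq_ij).
rewrite (@determinant_multilinear _ _ _ 1%:M C i 1 c) ?det1 ?C0 ?mulr1 ?mulr0 ?addr0 //.
- by apply/rowP=> l; rewrite !mxE eqxx mul1r [l == j]eq_sym.
- apply/matrixP=> k l; rewrite !mxE.
  by rewrite (eq_sym _ i) (negPf (neq_lift _ _)) mulr0 addr0.
- apply/matrixP=> k l; rewrite !mxE.
  by rewrite (eq_sym _ i) (negPf (neq_lift _ _)) mulr0 addr0.
Qed.

Lemma mul_transvectionE (R : comNzRingType) m n (i j : 'I_m) (c : R)
    (A : 'M[R]_(m, n)) k l :
  ((1%:M + c *: delta_mx i j) *m A) k l = A k l + c * ((k == i)%:R * A j l).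
Proof.
rewrite mulmxDl mul1mx -scalemxAl !mxE (bigD1 j) //= mxE eqxx andbT.
rewrite big1 ?addr0 // => s neq_sj.
by rewrite mxE (negPf neq_sj) andbF mul0r.
Qed.

Lemma mul_tr_transvectionE (R : comNzRingType) m n (i j : 'I_n) (c : R)
    (A : 'M[R]_(m, n)) k l :
  (A *m (1%:M + c *: delta_mx i j)^T) k l = A k l + c * ((l == i)%:R * A k j).
Proof.
by rewrite -[A]trmxK -trmx_mul mxE mul_transvectionE !mxE.
Qed.

Lemma adjmx_add_vertex (R : realType) (V : finType) (G : wgraph R V) (v u : V)
    (c : R) (P := 1%:M + c *: delta_mx (enum_rank v) (enum_rank u)) :
  weight G v u = 0 -> adjmx (add_vertex G v u c) = P *m adjmx G *m P^T.
Proof.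
move=> wvu; apply/matrixP=> i j.
rewrite mul_tr_transvectionE !mul_transvectionE !mxE /= !enum_rankK.
(* The term in [c] squared carries the weight of the pair [u], [u], which is 0. *)
rewrite weight_diag /add_weight.
rewrite -!(inj_eq enum_val_inj) !enum_rankK.
move: (enum_val i) (enum_val j) => a b.
have wuv : weight G u v = 0 by rewrite weight_sym.
have [<-|neq_ab] := eqVneq a b.
  (* On the diagonal at [v], the row and column operations each contribute [c] times the weight of
     [uv]; this is where non-adjacency enters. *)
  case: (eqVneq a v) => [->|_].
    by rewrite wuv wvu weight_diag !(mulr0, addr0).
  by rewrite weight_diag !(mul0r, mulr0, addr0).
(* Off the diagonal at most one of [a], [b] is [v], so at most one of the two operations affects the
   entry. *)
case: (eqVneq a v) neq_ab => [->|_ _].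
  rewrite eq_sym => /negPf->.
  by rewrite mul1r !(mul0r, mulr0, addr0) (weight_sym G b u).
case: (eqVneq b v) => [->|_]; last by rewrite !(mul0r, mulr0, addr0).
by rewrite mul1r !(mul0r, mulr0, addr0) (weight_sym G v a).
Qed.

Theorem theorem1 (R : realType) (V : finType) (G : wgraph R V) (x1 x2 : V)
    (c : R) (neq_x12 : x1 != x2) (nadj_x12 : ~~ edge G x1 x2) (c_neq0 : c != 0) :
  \det (adjmx G) = \det (adjmx (add_vertex G x1 x2 c)).
Proof.
have w0 : weight G x1 x2 = 0.
  by apply/eqP; rewrite -[_ == _]negbK weight_edge.
rewrite adjmx_add_vertex // !det_mulmx det_tr det_transvection ?mul1r ?mulr1 //.
by rewrite (inj_eq enum_rank_inj).
Qed.
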